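(* Let $P$ be a poset such that, for every nonempty subset $A$ of $P$ without a fusion in $P$, $\downarrow A$ is atomic, let $\alpha\colon P\hookrightarrow H(P)$ be the inclusion map, and let $e\colon P\to M$ be a dense fusion-completion of $P$. Then there is an injective fusion-preserving and order-preserving map $g\colon H(P)\to M$ such that $g\circ\alpha=e$.
   Context: In a poset $P$, $x\circ y$ (overlap) means that there is $z\in P$ with $z\le x$ and $z\le y$. For $A\subseteq P$, $\downarrow A=\{y\in P\mid y\le a\text{ for some }a\in A\}$. An atom of a poset is an element $x$ such that $y\le x$ implies $y=x$; a poset is atomic if every element has an atom below it (or equal to it); $\operatorname{Atoms}(P)$ is the set of atoms of $P$. For $x\in P$ let $\mathsf{O}(x)=\{y\in P\mid x\circ y\}$, and for $A\subseteq P$ let $\mathsf{O}(A)=\bigcup\{\mathsf{O}(x)\mid x\in A\}$. For $\varnothing\ne A\subseteq P$, an element $x\in P$ is a fusion of $A$ if for every $y\in P$: $y\circ x$ if and only if $y\circ z$ for some $z\in A$. A poset is fusion-complete if every nonempty subset has a fusion. A map $f$ of posets is order-preserving if $x\le y$ implies $f(x)\le f(y)$, and an order-embedding if $x\le y\iff f(x)\le f(y)$. A map $f\colon P\to M$ is: $\circ$-reflecting if $f(x)\circ f(y)$ implies $x\circ y$; fusion-preserving if $f(x)$ is a fusion of $f(A)$ in $M$ whenever $x\in P$ is a fusion of $A\subseteq P$; fusion-dense if for every $m\in M$ there is $A\subseteq P$ such that $m$ is a fusion of $f(A)$ in $M$; dense if for every $m\in M$ there is $p\in P$ with $f(p)\le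 m$. A fusion-completion of $P$ is a fusion-complete poset $M$ together with a $\circ$-reflecting, fusion-preserving and fusion-dense order-embedding $e\colon P\to M$; it is dense if $e$ is dense. $H(P)$ is the set $P\cup\{f_{\mathsf{O}(A)}\mid \varnothing\neq A\subseteq P\text{ has no fusion in }P\}$, where the $f_{\mathsf{O}(A)}$ are new formal elements not in $P$, indexed by the sets $\mathsf{O}(A)$ (so $f_{\mathsf{O}(A)}=f_{\mathsf{O}(B)}$ iff $\mathsf{O}(A)=\mathsf{O}(B)$). Its order $\sqsubseteq$ is: on $P$ the given order; each $f_{\mathsf{O}(A)}\sqsubseteq f_{\mathsf{O}(A)}$; for $x\in P$, $x\sqsubseteq f_{\mathsf{O}(A)}$ iff $x\in\operatorname{Atoms}(P)$ and $\mathsf{O}(x)\subseteq\mathsf{O}(A)$; distinct new elements are incomparable; and no new element is below an element of $P$. *)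

(* Defs.v *)
From HB Require Import structures.
From mathcomp Require Import all_boot all_order.
From mathcomp Require Import boolp classical_sets.

Set Implicit Arguments.
Unset Strict Implicit.
Unset Printing Implicit Defensive.

Import Order.TTheory.
Local Open Scope classical_set_scope.
Local Open Scope order_scope.

(* Posets are porderTypes. With the classical axioms of boolp every partially
   ordered type carries such a structure, so this is no restriction. *)

(* The induced order on a subset A, seen as a type through [set_type A]. *)
HB.instance Definition _ (d : Order.disp_t) (T : porderType d) (A : set T) :=
  [SubChoice_isSubPOrder of {x : T | x \in A} by <: with d].

Section Overlap.
Context {d : Order.disp_t} {P : porderType d}.
Implicit Types (x y : P) (A : set P).

Definition overlap x y : Prop := exists z : P, z <= x /\ z <= y.

Definition downset A : set P := [set y | exists2 a, A a & y <= a].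

Definition overlaps x : set P := [set y | overlap x y].

Definition overlaps_set A : set P := \bigcup_(x in A) overlaps x.

Definition is_fusion A x : Prop :=
  A !=set0 /\ forall y, overlap y x <-> exists2 z, A z & overlap y z.

Definition has_fusion A : Prop := exists x, is_fusion A x.

End Overlap.

Definition atoms (d : Order.disp_t) (P : porderType d) : set P :=
  [set x | forall y : P, y <= x -> y = x].
Arguments atoms {d} P _.

Definition atomic (d : Order.disp_t) (P : porderType d) : Prop :=
  forall x : P, exists2 a : P, atoms P a & a <= x.

Definition fusion_complete (d : Order.disp_t) (P : porderType d) : Prop :=
  forall A : set P, A !=set0 -> has_fusion A.

Section Maps.
Context {d d' : Order.disp_t} {P : porderType d} {M : porderType d'}.
Implicit Type f : P -> M.

Definition order_preserving f : Prop := {homo f : x y / x <= y}.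

Definition order_embedding f : Prop := {mono f : x y / x <= y}.

Definition overlap_reflecting f : Prop :=
  forall x y : P, overlap (f x) (f y) -> overlap x y.

Definition fusion_preserving f : Prop :=
  forall (A : set P) (x : P), is_fusion A x -> is_fusion (f @` A) (f x).

Definition fusion_dense f : Prop :=
  forall m : M, exists A : set P, is_fusion (f @` A) m.

Definition dense_map f : Prop := forall m : M, exists p : P, f p <= m.

Definition fusion_completion f : Prop :=
  [/\ fusion_complete M, order_embedding f, overlap_reflecting f,
      fusion_preserving f & fusion_dense f].

Definition dense_fusion_completion f : Prop :=
  fusion_completion f /\ dense_map f.

End Maps.

Section HPoset.
Context {d : Order.disp_t} (P : porderType d).

Definition unfused_overlaps : set (set P) :=
  [set overlaps_set A | A in [set A : set P | A !=set0 /\ ~ has_fusion A]].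

(* [Hnew F] is the formal element f_O(A), where O(A) is the set underlying F,
   for some nonempty A without a fusion; it depends on A only through the set O(A). *)
Inductive Hposet : Type :=
| Hold of P
| Hnew of set_type unfused_overlaps.

HB.instance Definition _ := gen_eqMixin Hposet.
HB.instance Definition _ := gen_choiceMixin Hposet.

Definition Hle_prop (u v : Hposet) : Prop :=
  match u, v with
  | Hold x, Hold y => x <= y
  | Hold x, Hnew F => atoms P x /\ overlaps x `<=` val F
  | Hnew F, Hnew G => F = G
  | Hnew _, Hold _ => False
  end.

Definition Hle (u v : Hposet) : bool := `[< Hle_prop u v >].

Lemma Hle_refl : reflexive Hle.
Proof. by move=> [x|F]; apply/asboolP => /=. Qed.

Lemma Hle_anti : antisymmetric Hle.
Proof.
move=> [x|F] [y|G] /andP[/asboolP /= h1 /asboolP /= h2] //.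
- by rewrite (le_anti (introT andP (conj h1 h2))).
- by rewrite h1.
Qed.

Lemma Hle_trans : transitive Hle.
Proof.
move=> [y|G] [x|F] [z|H] /asboolP /= h1 /asboolP /= h2 //; apply/asboolP => //=.
- exact: le_trans h1 h2.
- by have [yat _] := h2; rewrite (yat _ h1).
- by rewrite -h2.
- by rewrite h1.
Qed.

HB.instance Definition _ := Order.Le_isPOrder.Build d Hposet
  Hle_refl Hle_anti Hle_trans.

End HPoset.

Arguments unfused_overlaps {d} P.
Arguments Hold {d P}.
Arguments Hnew {d P}.

(* Main.v *)
Require Import Defs.
From mathcomp Require Import all_boot all_order.
From mathcomp Require Import boolp classical_sets.

Set Implicit Arguments.
Unset Strict Implicit.
Unset Printing Implicit Defensive.

Import Order.TTheory.
Local Open Scope classical_set_scope.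
Local Open Scope order_scope.

(** The map [g] is [e] on [P] and sends a new element [F = O(A)] to a fusion of
    [e @` A] in [M], for some chosen [A].

    Everything is read off from overlap with the elements of [P]. Since [e]
    reflects overlap, [e y] overlaps a fusion of [e @` A] iff [y] lies in [O(A)]
    ([overlap_image_fusion]); so a fusion of [e @` A] determines [O(A)], and if it
    is [e x] then [x] is a fusion of [A]: hence [g] is injective. Since [e] is
    dense, it sends atoms to atoms ([dense_atom]), and an atom is below whatever
    it overlaps, so [g] preserves the order.

    The atomicity hypothesis says that [y] in [O(A)] is witnessed by an atom
    below [y] and below an element of [A], that is, by a common lower bound of
    [y] and [F = O(A)] in [Hposet P] ([overlap_Hold_Hnew]). Thus [Hold y] overlaps
    [u] iff [e y] overlaps [g u]. By density the overlaps of an element of [M]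
    are tested on the [e y] below it ([dense_overlap]), so [g] preserves
    fusions. *)

Section OverlapTheory.
Context {d : Order.disp_t} {P : porderType d}.
Implicit Types (x y z : P) (A : set P).

Lemma overlap_refl x : overlap x x.
Proof. by exists x. Qed.

Lemma overlap_sym x y : overlap x y -> overlap y x.
Proof. by move=> [z [zx zy]]; exists z. Qed.

Lemma overlap_le x y z : x <= y -> overlap x z -> overlap y z.
Proof. by move=> xy [t [tx tz]]; exists t; split=> //; apply: le_trans xy. Qed.

Lemma atom_overlap_le x y : atoms P x -> overlap x y -> x <= y.
Proof. by move=> xat [z [/xat -> zy]]. Qed.

(** A lower bound in [P] of an element of the downset lies in the downset, so
    atoms of the downset are atoms of [P]. *)
Lemma atomic_downset A x : atomic (set_type (downset A)) -> downset A x ->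
  exists2 a, atoms P a & a <= x.
Proof.
move=> Aat Ax.
have [a aat ax] := Aat (exist _ x (mem_set Ax)).
exists (val a); last exact: ax.
move=> y ya.
have Ay : downset A y.
  have /set_mem[b Ab ab] := valP a.
  by exists b => //; apply: le_trans ab.
by have <- := aat (exist _ y (mem_set Ay)) ya.
Qed.

End OverlapTheory.

Section Embedding.
Context {d d' : Order.disp_t} {P : porderType d} {M : porderType d'}.
Variable e : P -> M.
Hypotheses (e_emb : order_embedding e) (e_dense : dense_map e).

Lemma dense_atom x : atoms P x -> atoms M (e x).
Proof.
move=> xat m mx; apply: le_anti; rewrite mx /=.
have [p pm] := e_dense m.
have px : p <= x by rewrite -e_emb (le_trans pm mx).
by rewrite -(xat p px).
Qed.

Lemma dense_overlap m n :
  overlap m n <-> exists2 p, e p <= m & overlap (e p) n.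
Proof.
split=> [[k [km kn]]|[p pm pn]]; last exact: overlap_le pn.
have [p pk] := e_dense k; exists p; first exact: le_trans km.
by exists (e p); split=> //; apply: le_trans kn.
Qed.

Hypothesis e_reflect : overlap_reflecting e.

Lemma overlap_embedding x y : overlap (e x) (e y) <-> overlap x y.
Proof.
split; first exact: e_reflect.
by move=> [z [zx zy]]; exists (e z); rewrite !e_emb.
Qed.

Lemma overlap_image_fusion (A : set P) m y : is_fusion (e @` A) m ->
  overlap (e y) m <-> overlaps_set A y.
Proof.
move=> [_ fm]; split.
- move=> /fm[_ [a Aa <-]] /overlap_embedding ya.
  by exists a => //; apply: overlap_sym.
- move=> [a Aa /overlap_sym ya]; apply/fm; exists (e a); first by exists a.
  exact/overlap_embedding.
Qed.

Lemma is_fusion_of_image (A : set P) x : is_fusion (e @` A) (e x) ->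
  is_fusion A x.
Proof.
move=> fx; split; first by have [[_ [a Aa _]] _] := fx; exists a.
move=> y; rewrite -overlap_embedding (overlap_image_fusion _ fx).
by split=> -[a Aa /overlap_sym]; exists a.
Qed.

End Embedding.

Section HposetOverlap.
Context {d : Order.disp_t} {P : porderType d}.
Implicit Types (x y : P) (u v : Hposet P) (F : set_type (unfused_overlaps P)).

Lemma HleP u v : (u <= v) <-> Hle_prop u v.
Proof. by split=> [/asboolP|uv]; last exact/asboolP. Qed.

Lemma overlap_Hold x y : overlap (Hold x) (Hold y) <-> overlap x y.
Proof.
split=> [[[z|F] [/HleP zx /HleP zy]] //|[z [zx zy]]]; first by exists z.
by exists (Hold z); split; apply/HleP.
Qed.

(** Only atoms of [P] lie below a new element, so the right-to-left direction
    needs an atom below a common lower bound of [y] and an element of [A]. *)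
Lemma overlap_Hold_Hnew (A : set P) F y :
  atomic (set_type (downset A)) -> overlaps_set A = val F ->
  overlap (Hold y) (Hnew F) <-> overlaps_set A y.
Proof.
move=> Aat AF; split.
- move=> [[z|G] [/HleP zy /HleP zF]] //; case: zF => _; rewrite -AF => zA.
  have [a Aa az] := zA z (overlap_refl z).
  by exists a => //; apply/overlap_sym/(overlap_le zy)/overlap_sym.
- move=> [a Aa [z [za zy]]].
  have [w wat wz] : exists2 w, atoms P w & w <= z.
    by apply: atomic_downset Aat _; exists a.
  exists (Hold w); split; apply/HleP; first exact: le_trans zy.
  split=> // t wt; rewrite -AF; exists a => //.
  by apply: overlap_le wt; apply: le_trans za.
Qed.

End HposetOverlap.

Theorem theorem7p5 (d d' : Order.disp_t) (P : porderType d) (M : porderType d')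
  (hP : forall A : set P, A !=set0 -> ~ has_fusion A ->
          atomic (set_type (downset A)))
  (e : P -> M) (he : dense_fusion_completion e) :
  exists g : Hposet P -> M,
    [/\ injective g, fusion_preserving g, order_preserving g & g \o Hold = e].
Proof.
have [[Mcomp e_emb e_reflect _ _] e_dense] := he.
have /choice[h hh] : forall F : set_type (unfused_overlaps P), exists m : M,
    exists A : set P, [/\ A !=set0, ~ has_fusion A, overlaps_set A = val F
                        & is_fusion (e @` A) m].
  move=> F; have /set_mem[A [[a Aa] nA] AF] := valP F.
  have [m fm] : has_fusion (e @` A) by apply: Mcomp; exists (e a), a.
  by exists m, A; split=> //; exists a.
(* [h] gives, for each new element [O(A)], a fusion of some [e @` A]. *)
pose g u := match u with Hold x => e x | Hnew F => h F end.
have overlap_g y u : overlap (Hold y) u <-> overlap (e y) (g u).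
  case: u => [x|F] /=.
    by rewrite overlap_Hold overlap_embedding.
  have [A [A0 nA AF fA]] := hh F.
  by rewrite (overlap_Hold_Hnew _ (hP A A0 nA) AF) (overlap_image_fusion _ _ _ fA).
have e_neq_h x F : e x <> h F.
  have [A [_ nA _ fA]] := hh F.
  by move=> exF; apply: nA; exists x; apply: is_fusion_of_image; rewrite // exF.
exists g; split=> //.
- move=> [x|F] [y|G] //=.
  + by move=> exy; congr Hold; apply: le_anti; rewrite -!e_emb exy lexx.
  + by move=> /e_neq_h.
  + by move=> /esym /e_neq_h.
  + move=> hFG; congr Hnew; apply: val_inj.
    have [A [_ _ <- fA]] := hh F; have [B [_ _ <- fB]] := hh G.
    apply/seteqP; split=> y.
      rewrite -(overlap_image_fusion e_emb e_reflect y fA) hFG.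
      by rewrite (overlap_image_fusion e_emb e_reflect y fB).
    rewrite -(overlap_image_fusion e_emb e_reflect y fB) -hFG.
    by rewrite (overlap_image_fusion e_emb e_reflect y fA).
- move=> X u [[x0 Xx0] fu]; split; first by exists (g x0), x0.
  move=> m; split.
  + move=> /(dense_overlap e_dense)[p pm /overlap_g/fu[x Xx /overlap_g px]].
    by exists (g x); [exists x | apply: overlap_le px].
  + move=> [_ [x Xx <-]] /(dense_overlap e_dense)[p pm /overlap_g px].
    apply/(dense_overlap e_dense); exists p => //.
    by apply/overlap_g/fu; exists x.
- move=> [x|F] [y|G] /HleP //=; first by rewrite e_emb.
  + move=> [xat xG]; have [A [_ _ AG fA]] := hh G.
    apply: atom_overlap_le; first exact: dense_atom.
    apply/(overlap_image_fusion e_emb e_reflect _ fA); rewrite AG.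
    exact/xG/overlap_refl.
  + by move=> ->.
Qed.
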